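(* Let $n\ge 2$. There is a constant $C$, depending only on $n$, such that every convex polytope $P\subset\mathbb{H}^n$ with $N$ top-dimensional faces (facets) satisfies $$ r(P)\le C\log N .$$ That is, $r(P)=O(\log N)$.
   Context: $\mathbb{H}^n$ is hyperbolic $n$-space. A convex polytope $P\subset\mathbb{H}^n$ is an $n$-dimensional convex polytope with finitely many faces and no hyperideal vertices, i.e. the hyperbolic convex hull (with nonempty interior) of finitely many points of $\mathbb{H}^n\cup\partial\mathbb{H}^n$; its vertices may be finite (in $\mathbb{H}^n$) or ideal (in $\partial\mathbb{H}^n$). Its top-dimensional faces are its $(n-1)$-dimensional faces. The radius $r(P)$ is the radius of the largest hyperbolic ball contained in $P$. *)

(* Defs.v *)
From mathcomp Require Import all_boot all_order all_algebra.
From mathcomp Require Import all_classical all_reals all_analysis.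
Set Implicit Arguments.
Unset Strict Implicit.
Unset Printing Implicit Defensive.
Import Order.TTheory GRing.Theory Num.Theory.

Local Open Scope classical_set_scope.
Local Open Scope ring_scope.

(* Hyperbolic n-space is the hyperboloid model: the sheet <x,x> = -1, x_0 > 0
   of R^(n+1), where <.,.> has signature (n,1).  A point at infinity is a
   future null line, represented by its unique vector with x_0 = 1. *)
Section Hyperboloid.
Variables (R : realType) (n : nat).
Local Notation vec := 'rV[R]_n.+1.

Definition lorentz (x y : vec) : R :=
  \sum_(i < n) x 0 (lift ord0 i) * y 0 (lift ord0 i) - x 0 ord0 * y 0 ord0.

Definition hspace : set vec := [set x | lorentz x x = -1 /\ 0 < x 0 ord0].

Definition hboundary : set vec := [set x | lorentz x x = 0 /\ x 0 ord0 = 1].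

Definition arcosh (t : R) : R := ln (t + Num.sqrt (t ^+ 2 - 1)).

(* cosh (hdist x y) = - <x,y> *)
Definition hdist (x y : vec) : R := arcosh (- lorentz x y).

Definition hball (c : vec) (r : R) : set vec :=
  [set x | hspace x /\ hdist c x <= r].

(* Geodesics are the intersections of hspace with linear planes, so the
   geodesic joining u and v (a segment, ray or line, according to how many of
   u and v are ideal) is the set of points of hspace in the cone on u and v. *)
Definition hgeodesic (u v : vec) : set vec :=
  [set z | hspace z /\
    exists a b : R, [/\ 0 <= a, 0 <= b & z = a *: u + b *: v]].

Definition hconvex (K : set vec) : Prop :=
  K `<=` hspace `|` hboundary /\
  forall u v, K u -> K v -> hgeodesic u v `<=` K.

Definition hhull (V : set vec) : set vec :=
  smallest hconvex V `&` hspace.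

Definition hpolytope (P : set vec) : Prop :=
  (exists V : set vec,
    [/\ finite_set V, V `<=` hspace `|` hboundary & P = hhull V]) /\
  (exists c r, [/\ hspace c, 0 < r & hball c r `<=` P]).

(* Hyperbolic hyperplanes are cut out by spacelike normal vectors a. *)
Definition hface (P F : set vec) : Prop :=
  exists a : vec, [/\ 0 < lorentz a a,
    P `<=` [set x | lorentz a x <= 0] &
    F = P `&` [set x | lorentz a x = 0]].

(* F lies in, and spans, a k-dimensional hyperbolic subspace, i.e. the linear
   span of F has dimension k + 1. *)
Definition hdim (F : set vec) (k : nat) : Prop :=
  exists M : 'M[R]_(k.+1, n.+1),
    [/\ row_free M, (forall i, F (row i M)) &
        (forall x, F x -> (x <= M)%MS)].

Definition facets (P : set vec) : set (set vec) :=
  [set F | hface P F /\ hdim F n.-1].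

Definition inradius (P : set vec) : \bar R :=
  ereal_sup [set r%:E | r in
    [set r : R | 0 < r /\ exists2 c, hspace c & hball c r `<=` P]].

End Hyperboloid.

(* Main.v *)
Require Import Defs.
From mathcomp Require Import all_boot all_order all_algebra.
From mathcomp Require Import all_classical all_reals all_analysis.
From mathcomp Require Import ring lra.
Import Order.TTheory GRing.Theory Num.Theory.
Local Open Scope classical_set_scope.
Local Open Scope ring_scope.

(** Suppose that the ball of centre [c] and radius [r] lies in [P].  Seen from
    [c], a hyperplane missing the ball covers a cap of angular radius of order
    [exp (- r)] on the sphere of directions.  Since [P] has no hyperideal
    vertex, a vector [c + y] with [y] tangent at [c] and slightly longer than
    [1] is spacelike and lies outside the cone over [P], so it is cut off by
    some facet; and covering even one circle of directions by such small caps
    takes of order [exp r] facets.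

    No measure or angle is needed to count.  Choose tangent vectors [x_j] of
    common length slightly above [1] in a plane.  If [c + x_j] and [c + x_k] are
    strictly beyond the same facet, so is their midpoint
    [c + (x_j + x_k) / 2]; but when [x_j] and [x_k] are at distance at least a
    constant times [1 / cosh r], the midpoint is timelike and its ray meets the
    ball, hence [P] ([hball_ray]).  So distinct [x_j] are cut off by distinct
    facets ([facet_count]), and there is room for about [exp r / 8] of them.
    Two opposite vectors already give two facets, which lets [ln N] absorb the
    additive constant.

    The remaining point is that a vector [c + y] as above is cut off by a facet
    in the strict sense, a face spanning a hyperplane
    ([exists_separating_facet]).  A null functional is nonpositive on the
    future cone, hence on the generators of [P], and positive at [c + y]; it is
    then tilted, keeping both properties, until the generators on which it
    vanishes span a hyperplane ([exists_facet_normal]).  Those generators may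
    all be ideal, but positive combinations of them are timelike and still
    belong to the hull, so the face spans its hyperplane inside hyperbolic
    space ([active_facet]). *)

(** * The Lorentz form *)

Section LorentzForm.
Context {R : realType} {n : nat}.
Implicit Types (x y z c a : 'rV[R]_n.+1) (t u : R).

Lemma lorentzC x y : lorentz x y = lorentz y x.
Proof.
rewrite /lorentz; congr (_ - _); last exact: mulrC.
by apply: eq_bigr => i _; rewrite mulrC.
Qed.

Lemma lorentzDr x y z : lorentz x (y + z) = lorentz x y + lorentz x z.
Proof.
rewrite /lorentz (eq_bigr (fun i => x 0 (lift ord0 i) * y 0 (lift ord0 i) +
  x 0 (lift ord0 i) * z 0 (lift ord0 i))) => [|i _]; last by rewrite !mxE mulrDr.
by rewrite big_split /= !mxE; ring.
Qed.

Lemma lorentzZr x y t : lorentz x (t *: y) = t * lorentz x y.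
Proof.
rewrite /lorentz (eq_bigr (fun i => t * (x 0 (lift ord0 i) *
  y 0 (lift ord0 i)))) => [|i _]; last by rewrite !mxE mulrCA.
by rewrite -mulr_sumr !mxE; ring.
Qed.

Lemma lorentzDl x y z : lorentz (y + z) x = lorentz y x + lorentz z x.
Proof. by rewrite lorentzC lorentzDr !(lorentzC x). Qed.

Lemma lorentzZl x y t : lorentz (t *: y) x = t * lorentz y x.
Proof. by rewrite lorentzC lorentzZr lorentzC. Qed.

Lemma lorentz0r x : lorentz x 0 = 0.
Proof. by rewrite -(scale0r 0) lorentzZr mul0r. Qed.

Lemma lorentzNr x y : lorentz x (- y) = - lorentz x y.
Proof. by rewrite -scaleN1r lorentzZr mulN1r. Qed.

Lemma lorentzNl x y : lorentz (- y) x = - lorentz y x.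
Proof. by rewrite lorentzC lorentzNr lorentzC. Qed.

Definition lorentzE := (lorentzDl, lorentzDr, lorentzZl, lorentzZr,
  lorentzNl, lorentzNr).

Lemma lorentz_sumr (I : Type) (s : seq I) (P : pred I) (F : I -> 'rV[R]_n.+1) x :
  lorentz x (\sum_(i <- s | P i) F i) = \sum_(i <- s | P i) lorentz x (F i).
Proof. exact: (big_morph _ (lorentzDr x) (lorentz0r x)). Qed.

Lemma lorentz_mulmx m (w : 'rV[R]_m) (X : 'M[R]_(m, n.+1)) x :
  lorentz x (w *m X) = \sum_i w 0 i * lorentz x (row i X).
Proof.
by rewrite mulmx_sum_row lorentz_sumr; apply: eq_bigr => i _; rewrite lorentzZr.
Qed.

Lemma lorentz_spatial_ge0 x : x 0 ord0 = 0 -> 0 <= lorentz x x.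
Proof.
by move=> x0; rewrite /lorentz x0 mulr0 subr0 sumr_ge0 // => i _; rewrite -expr2 sqr_ge0.
Qed.

Lemma lorentz_spatial_eq0 x : x 0 ord0 = 0 -> lorentz x x <= 0 -> x = 0.
Proof.
move=> x0; rewrite /lorentz x0 mulr0 subr0 => le0.
have ge0 i : 0 <= x 0 (lift ord0 i) * x 0 (lift ord0 i) by rewrite -expr2 sqr_ge0.
have /eqP : \sum_(i < n) x 0 (lift ord0 i) * x 0 (lift ord0 i) = 0.
  by apply/eqP; rewrite eq_le le0 sumr_ge0.
rewrite psumr_eq0 // => /allP h; apply/rowP => j; rewrite mxE.
case: (unliftP ord0 j) => [i|] -> //.
by have := h i (mem_index_enum i); rewrite /= mulf_eq0 orbb => /eqP.
Qed.

(** Comparing two vectors after rescaling them to the same time coordinate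
    leaves a purely spatial vector, on which the form is positive definite:
    every reversed Cauchy-Schwarz statement below is read off from it. *)
Lemma spatial_diff_lorentz x y :
  let d := y 0 ord0 *: x - x 0 ord0 *: y in
  d 0 ord0 = 0 /\ lorentz d d = y 0 ord0 ^+ 2 * lorentz x x
    - 2 * x 0 ord0 * y 0 ord0 * lorentz x y + x 0 ord0 ^+ 2 * lorentz y y.
Proof.
split; first by rewrite !mxE mulrC subrr.
by rewrite !lorentzE (lorentzC y x); ring.
Qed.

Definition future_causal x := lorentz x x <= 0 /\ 0 < x 0 ord0.

Lemma lorentz_future_le0 x y :
  future_causal x -> future_causal y -> lorentz x y <= 0.
Proof.
move=> [xx x0] [yy y0]; have [/lorentz_spatial_ge0 + e] := spatial_diff_lorentz x y.
rewrite e => ge0; have p : 0 < x 0 ord0 * y 0 ord0 by exact: mulr_gt0.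
rewrite -(pmulr_rle0 _ p).
have := mulr_ge0 (sqr_ge0 (y 0 ord0)) (_ : 0 <= - lorentz x x).
have := mulr_ge0 (sqr_ge0 (x 0 ord0)) (_ : 0 <= - lorentz y y).
by rewrite !oppr_ge0 => /(_ yy) ? /(_ xx) ?; lra.
Qed.

Lemma lorentz_future_eq0 x y : future_causal x -> future_causal y ->
  lorentz x y = 0 -> y 0 ord0 *: x = x 0 ord0 *: y.
Proof.
move=> [xx x0] [yy y0] xy; have [/lorentz_spatial_eq0 + e] := spatial_diff_lorentz x y.
rewrite e xy => h; apply/eqP; rewrite -subr_eq0; apply/eqP/h.
have := mulr_ge0 (sqr_ge0 (y 0 ord0)) (_ : 0 <= - lorentz x x).
have := mulr_ge0 (sqr_ge0 (x 0 ord0)) (_ : 0 <= - lorentz y y).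
by rewrite !oppr_ge0 => /(_ yy) ? /(_ xx) ?; lra.
Qed.

Lemma orth_timelike_spacelike c a :
  lorentz c c < 0 -> lorentz c a = 0 -> a != 0 -> 0 < lorentz a a.
Proof.
move=> cc ca a0; rewrite ltNge; apply/negP => aa.
have c0 : c 0 ord0 != 0.
  by apply: contraTneq cc => /lorentz_spatial_ge0; rewrite leNgt.
have [d0 e] := spatial_diff_lorentz c a.
have dd := lorentz_spatial_ge0 _ d0; rewrite e ca in dd.
have p : 0 < c 0 ord0 ^+ 2 by rewrite lt_def sqrf_eq0 c0 sqr_ge0.
have ac : a 0 ord0 ^+ 2 * lorentz c c <= 0.
  by rewrite mulr_ge0_le0 ?sqr_ge0 // ltW.
have caa : c 0 ord0 ^+ 2 * lorentz a a <= 0 by rewrite mulr_ge0_le0 ?sqr_ge0.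
have ac0 : a 0 ord0 ^+ 2 * lorentz c c = 0 by lra.
have /eqP : a 0 ord0 = 0.
  by move/eqP: ac0; rewrite mulf_eq0 sqrf_eq0 (lt_eqF cc) orbF => /eqP.
move/eqP => /lorentz_spatial_eq0 /(_ aa) a0'.
by rewrite a0' eqxx in a0.
Qed.

Lemma future_causal_of_lorentz c z : future_causal c ->
  lorentz z z <= 0 -> lorentz c z < 0 -> future_causal z.
Proof.
move=> fc zz cz; split=> //; rewrite ltNge; apply/negP.
rewrite le_eqVlt => /orP[/eqP z0|z0].
  by move: cz; rewrite (lorentz_spatial_eq0 _ z0 zz) lorentz0r ltxx.
have fz : future_causal (- z) by split; rewrite ?lorentzE ?opprK // !mxE oppr_gt0.
by have := lorentz_future_le0 _ _ fc fz; rewrite lorentzE oppr_le0 leNgt cz.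
Qed.

Lemma future_causal_spanned x y t u : 0 <= t -> 0 <= u -> 0 < t + u ->
  future_causal x -> future_causal y -> future_causal (t *: x + u *: y).
Proof.
move=> t0 u0 tu fx fy; have := lorentz_future_le0 _ _ fx fy.
case: fx fy => [xx x0] [yy y0] xy; split.
  rewrite !lorentzE (lorentzC y x).
  have : t * (t * lorentz x x) <= 0 by do 2 rewrite mulr_ge0_le0 //.
  have : t * (u * lorentz x y) <= 0 by do 2 rewrite mulr_ge0_le0 //.
  have : u * (u * lorentz y y) <= 0 by do 2 rewrite mulr_ge0_le0 //.
  by lra.
rewrite !mxE; move: t0 tu; rewrite le_eqVlt => /orP[/eqP<-|t0] tu.
- by rewrite add0r in tu; rewrite mul0r add0r mulr_gt0.
- by apply: ltr_pwDl; [exact: mulr_gt0 | apply: mulr_ge0 => //; exact: ltW].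
Qed.

(** A vector orthogonal to the rows for the Euclidean product becomes orthogonal
    for the Lorentz form when its time coordinate changes sign. *)
Lemma exists_orthogonal m (A : 'M[R]_(m, n.+1)) : (\rank A < n.+1)%N ->
  exists2 g : 'rV[R]_n.+1, g != 0 & forall i, lorentz g (row i A) = 0.
Proof.
move=> rkA; have : cokermx A != 0.
  by rewrite -mxrank_eq0 mxrank_coker subn_eq0 -ltnNge.
move: (cokermx A) (mulmx_coker A) => B AB /eqP/matrixP nz.
have [i [j ij]] : exists i j, B i j != 0.
  apply: contrapT => h; apply: nz => i j; rewrite mxE; apply/eqP/negPn/negP => ij.
  by apply: h; exists i, j.
pose g : 'rV[R]_n.+1 := \row_k (if k == ord0 then - B k j else B k j).
exists g.
  apply: contraNneq ij => /rowP /(_ i); rewrite !mxE; case: ifP => _ /eqP //.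
  by rewrite oppr_eq0.
move=> k; move/matrixP: AB => /(_ k j); rewrite !mxE big_ord_recl /= => e.
rewrite /lorentz !mxE eqxx mulNr opprK addrC mulrC -[RHS]e; congr (_ + _).
by apply: eq_bigr => l _; rewrite !mxE mulrC.
Qed.

End LorentzForm.

(** * Balls of hyperbolic space *)

Section HyperbolicBalls.
Context {R : realType} {n : nat}.
Implicit Types (x y z c a : 'rV[R]_n.+1) (r t : R).

Definition cosh r : R := (expR r + expR (- r)) / 2.

Lemma cosh_gt1 r : 0 < r -> 1 < cosh r.
Proof.
move=> r0; rewrite /cosh.
have e1 : expR r * expR (- r) = 1 by rewrite -expRD subrr expR0.
have e2 : 1 < expR r by rewrite expR_gt1.
have := expR_gt0 (- r); nra.
Qed.

Lemma arcosh_le p r : 0 <= r -> 1 <= p -> p <= cosh r -> arcosh p <= r.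
Proof.
move=> r0 p1 pr; have e1 : expR r * expR (- r) = 1 by rewrite -expRD subrr expR0.
have e2 : expR (- r) <= expR r by rewrite ler_expR; lra.
have h : Num.sqrt (p ^+ 2 - 1) <= (expR r - expR (- r)) / 2.
  have s0 : 0 <= (expR r - expR (- r)) / 2 by lra.
  rewrite -(ger0_norm s0) -sqrtr_sqr ler_wsqrtr //.
  have : p ^+ 2 <= cosh r ^+ 2 by rewrite ler_sqr ?nnegrE //; lra.
  rewrite /cosh; nra.
rewrite /arcosh -[leRHS]expRK ler_ln ?posrE ?expR_gt0 //.
  by rewrite /cosh in pr; lra.
by apply: ltr_pwDl; [lra | exact: sqrtr_ge0].
Qed.

Lemma orth_hspace_ge0 c y : hspace c -> lorentz c y = 0 -> 0 <= lorentz y y.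
Proof.
move=> [cc _] cy; have [->|y0] := eqVneq y 0; first by rewrite lorentz0r.
by apply/ltW/(orth_timelike_spacelike c) => //; rewrite cc ltrN10.
Qed.

(** The normalisation [z] of [c + y] has [- lorentz c z = (1 - |y|^2)^(-1/2)], so
    in the projective model centred at [c] the ball of radius [r] is the
    Euclidean ball [|y| <= tanh r]; the hypothesis is this inequality, cleared
    of denominators. *)
Lemma hball_ray c r y : hspace c -> 0 <= r -> lorentz c y = 0 ->
  1 <= cosh r ^+ 2 * (1 - lorentz y y) ->
  exists2 t, 0 < t & hball c r (t *: (c + y)).
Proof.
move=> hc r0 cy hy; have y0 := orth_hspace_ge0 _ _ hc cy.
have [cc c0] := hc.
set q := 1 - lorentz y y in hy.
have q1 : q <= 1 by rewrite /q; lra.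
have q0 : 0 < q.
  rewrite ltNge; apply/negP => q0.
  by have := mulr_ge0_le0 (sqr_ge0 (cosh r)) q0; lra.
have s0 : 0 < Num.sqrt q by rewrite sqrtr_gt0.
have sq : Num.sqrt q ^+ 2 = q by rewrite sqr_sqrtr // ltW.
pose t := (Num.sqrt q)^-1.
have t0 : 0 < t by rewrite invr_gt0.
have tq : t ^+ 2 * q = 1 by rewrite -sq -exprMn mulVf ?expr1n // gt_eqF.
have ez : lorentz (t *: (c + y)) (t *: (c + y)) = -1.
  by transitivity (- (t ^+ 2 * q)); [rewrite !lorentzE (lorentzC y c) cc cy /q; ring | rewrite tq].
have ecz : lorentz c (t *: (c + y)) = - t.
  by rewrite !lorentzE cc cy; ring.
exists t => //; split.
  split=> //.
  have fc : future_causal c by split=> //; rewrite cc lerN10.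
  by have [] := future_causal_of_lorentz _ (t *: (c + y)) fc;
    rewrite ?ez ?ecz ?lerN10 ?oppr_lt0.
rewrite /hdist ecz opprK; apply: arcosh_le => //.
  by rewrite -(@ler_sqr _ 1) ?nnegrE ?ler01 ?(ltW t0) // expr1n -tq ler_piMr // sqr_ge0.
have ch0 : 0 <= cosh r by rewrite /cosh; have := expR_gt0 r; have := expR_gt0 (- r); lra.
rewrite -ler_sqr ?nnegrE ?(ltW t0) //.
have := ler_wpM2l (sqr_ge0 t) hy; rewrite mulr1 mulrCA tq mulr1.
exact.
Qed.

(** If [a] vanished at the centre it would be spacelike, and moving from [c] a
    little in the direction of [a] would leave the half-space but not the
    ball. *)
Lemma hball_halfspace_lt c r a : hspace c -> 0 < r -> a != 0 ->
  (forall x, hball c r x -> lorentz a x <= 0) -> lorentz a c < 0.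
Proof.
move=> hc r0 a0 h; have ch := cosh_gt1 _ r0.
have ray y : lorentz c y = 0 -> 1 <= cosh r ^+ 2 * (1 - lorentz y y) ->
    lorentz a (c + y) <= 0.
  move=> cy hy; have [t t0 /h] := hball_ray _ _ _ hc (ltW r0) cy hy.
  by rewrite lorentzZr pmulr_rle0.
rewrite lt_neqAle; apply/andP; split; last first.
  by rewrite -[c]addr0 ray ?lorentz0r // subr0 mulr1; nra.
apply/eqP => ac.
have aa : 0 < lorentz a a.
  by case: hc => [cc _]; apply: (orth_timelike_spacelike c);
    rewrite ?cc ?ltrN10 // lorentzC.
(* The bound [e * |a|^2 <= tanh r ^+ 2] and [e <= 1] give [|e a| <= tanh r]. *)
pose e := Num.min 1 ((1 - cosh r ^- 2) / lorentz a a).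
have ch2 : 0 < cosh r ^+ 2 by nra.
have k0 : 0 < 1 - cosh r ^- 2 by rewrite subr_gt0 invf_lt1 //; nra.
have e0 : 0 < e by rewrite lt_min ltr01 divr_gt0.
have e1 : e <= 1 by rewrite ge_min lexx.
have e2 : e * lorentz a a <= 1 - cosh r ^- 2.
  by rewrite -ler_pdivlMr // ge_min lexx orbT.
have := ray (e *: a); rewrite !lorentzE (lorentzC c) ac mulr0 add0r.
have -> : 1 <= cosh r ^+ 2 * (1 - e * (e * lorentz a a)).
  rewrite -ler_pdivrMl // mulr1.
  suff : e * (e * lorentz a a) <= e * lorentz a a by lra.
  by rewrite ler_piMl // mulr_ge0 // ltW.
by move=> /(_ erefl erefl); rewrite leNgt mulr_gt0.
Qed.

(** Otherwise both [a] and [- a] would be negative at the centre: a ball spans the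
    whole vector space. *)
Lemma hball_orth0 c r a : hspace c -> 0 < r ->
  (forall x, hball c r x -> lorentz a x = 0) -> a = 0.
Proof.
move=> hc r0 h; apply/eqP/negPn/negP => a0.
have pos b : b != 0 -> (forall x, hball c r x -> lorentz b x = 0) -> lorentz b c < 0.
  by move=> b0 hb; apply: (hball_halfspace_lt _ _ _ hc r0 b0) => x /hb ->.
have := pos _ a0 h; have := pos (- a).
rewrite oppr_eq0 lorentzNl oppr_lt0 => /(_ a0) hN.
have /hN : forall x, hball c r x -> lorentz (- a) x = 0.
  by move=> x /h e; rewrite lorentzNl e oppr0.
by lra.
Qed.

End HyperbolicBalls.

(** * Hyperbolic convex hulls and linear cones *)

Section Hull.
Context {R : realType} {n : nat}.
Local Notation hclosure := (@hspace R n `|` @hboundary R n).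
Implicit Types (V K : set 'rV[R]_n.+1) (x y z c a : 'rV[R]_n.+1) (t : R).

Lemma future_causal_hclosure x : hclosure x -> future_causal x.
Proof.
by move=> [[xx x0]|[xx x0]]; split; rewrite ?xx ?x0 ?lerN10 ?ltr01.
Qed.

Lemma timelike_normalize z : lorentz z z < 0 -> 0 < z 0 ord0 ->
  exists2 t, 0 < t & hspace (t *: z).
Proof.
move=> zz z0; exists (Num.sqrt (- lorentz z z))^-1.
  by rewrite invr_gt0 sqrtr_gt0 oppr_gt0.
split; last by rewrite mxE mulr_gt0 // invr_gt0 sqrtr_gt0 oppr_gt0.
rewrite lorentzZl lorentzZr mulrA -expr2 exprVn sqr_sqrtr ?oppr_ge0 ?(ltW zz) //.
by rewrite invrN mulNr mulVf // lt_eqF.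
Qed.

(** The closed half-space, with its ideal points, is itself convex. *)
Lemma hhull_halfspace V a : V `<=` hclosure ->
  (forall v, V v -> lorentz a v <= 0) -> forall x, hhull V x -> lorentz a x <= 0.
Proof.
move=> sV aV x [].
suff /smallest_sub h : hconvex (hclosure `&` [set x | lorentz a x <= 0]).
  by move=> /h [] // v Vv; split; [exact: sV | exact: aV].
split=> [u []//|u v [_ au] [_ av] z [hz [s [t [s0 t0 ez]]]]]; split; first by left.
by rewrite /= ez !lorentzE -oppr_ge0 opprD addr_ge0 // oppr_ge0 mulr_ge0_le0.
Qed.

(** Partial sums of generators need not be normalised, and may be null; tracking
    only their rays makes membership in a convex set stable under addition. *)
Definition on_ray K x := x = 0 \/ exists t k, [/\ 0 < t, K k & x = t *: k].

Lemma on_rayD K x y : hconvex K -> on_ray K x -> on_ray K y -> on_ray K (x + y).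
Proof.
move=> [sK cK] [->|[s [k [s0 Kk ->]]]]; first by rewrite add0r.
case=> [->|[t [l [t0 Kl ->]]]]; first by rewrite addr0; right; exists s, k.
right; set z := s *: k + t *: l.
have fk := future_causal_hclosure _ (sK _ Kk).
have fl := future_causal_hclosure _ (sK _ Kl).
have fz : future_causal z.
  by apply: future_causal_spanned; rewrite ?ltW ?addr_gt0.
have [zz z0] := fz; move: zz; rewrite le_eqVlt => /orP[/eqP zz|zz]; last first.
  have [q q0 hq] := timelike_normalize _ zz z0.
  exists q^-1, (q *: z); split; rewrite ?invr_gt0 //; last first.
    by rewrite scalerA mulVf ?scale1r // gt_eqF.
  apply: (cK _ _ Kk Kl); split=> //.
  exists (q * s), (q * t); split; rewrite ?mulr_ge0 ?ltW //.
  by rewrite /z scalerDr !scalerA.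
(* A null sum of future causal vectors has null parallel summands, so [k] and
   [l] are the same ideal point. *)
have [kk0 k00] := fk; have [ll0 l00] := fl; have kl0 := lorentz_future_le0 _ _ fk fl.
have st : 0 < s * t by exact: mulr_gt0.
have ss : 0 < s * s by exact: mulr_gt0.
have tt : 0 < t * t by exact: mulr_gt0.
have e : lorentz z z = s * s * lorentz k k + 2 * (s * t * lorentz k l) + t * t * lorentz l l.
  by rewrite /z !lorentzE (lorentzC l k); ring.
rewrite zz in e.
have h1 : s * s * lorentz k k <= 0 by rewrite mulr_ge0_le0 // ltW.
have h2 : s * t * lorentz k l <= 0 by rewrite mulr_ge0_le0 // ltW.
have h3 : t * t * lorentz l l <= 0 by rewrite mulr_ge0_le0 // ltW.
have null u v : 0 < u -> u * v = 0 :> R -> v = 0.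
  by move=> u0 /eqP; rewrite mulf_eq0 gt_eqF //= => /eqP.
have kk : lorentz k k = 0 by apply: (null _ _ ss); lra.
have ll : lorentz l l = 0 by apply: (null _ _ tt); lra.
have kl : lorentz k l = 0 by apply: (null _ _ st); lra.
have bdry u : hclosure u -> lorentz u u = 0 -> u 0 ord0 = 1.
  by move=> [[-> _] /eqP|[_ //]]; rewrite oppr_eq0 oner_eq0.
have := lorentz_future_eq0 _ _ fk fl kl.
rewrite (bdry k) ?(bdry l) ?scale1r //; [|exact: sK..].
move=> ekl; exists (s + t), k; split; rewrite ?addr_gt0 //.
by rewrite /z -ekl scalerDl.
Qed.

(** Adding up the terms one at a time never leaves the rays of a convex set
    containing the generators, and a vector of hyperbolic space is its own
    normalisation on its ray. *)
Lemma hhull_cone V m (X : 'M[R]_(m, n.+1)) (w : 'rV[R]_m) :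
  V `<=` hclosure -> (forall i, V (row i X)) ->
  (forall i, 0 <= w 0 i) -> hspace (w *m X) -> hhull V (w *m X).
Proof.
move=> sV VX w0 hx; split=> // K [cK VK].
have : on_ray K (w *m X).
  rewrite mulmx_sum_row; apply: big_ind => [|x y|i _]; first by left.
    exact: on_rayD.
  have := w0 i; rewrite le_eqVlt => /orP[/eqP<-|wi]; first by left; rewrite scale0r.
  by right; exists (w 0 i), (row i X); split=> //; exact/VK.
move: hx => [xx x0] [e|[t [k [t0 Kk e]]]].
  by move: x0; rewrite e mxE ltxx.
have [kk|kk] := cK.1 _ Kk; last first.
  by move: xx => /eqP; rewrite e !lorentzE kk.1 !mulr0 eq_sym oppr_eq0 oner_eq0.
have : t ^+ 2 = 1 ^+ 2.
  by move: xx; rewrite e !lorentzE kk.1 expr1n; lra.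
move=> /eqP; rewrite eqrXn2 ?ltW // ?ltr01 // => /eqP t1.
by rewrite e t1 scale1r.
Qed.

End Hull.

(** * Facets cutting off a vector *)

Section SupportingNormals.
Context {R : realType} {n m : nat}.
Variable X : 'M[R]_(m, n.+1).
Implicit Types (a f g u : 'rV[R]_n.+1).

(** The generators lying on the hyperplane orthogonal to [a]; the other rows
    are zeroed rather than removed, which keeps the dimensions fixed. *)
Definition active a : 'M[R]_(m, n.+1) :=
  \matrix_i (if lorentz a (row i X) == 0 then row i X else 0).

Lemma row_active a i :
  row i (active a) = if lorentz a (row i X) == 0 then row i X else 0.
Proof. by rewrite rowK. Qed.

Lemma active_orth a i : lorentz a (row i (active a)) = 0.
Proof. by rewrite row_active; case: eqP => // _; rewrite lorentz0r. Qed.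

(** The constraints on [g] have rank at most [n] because [u] adds at most one
    to the rank of the active generators; up to its sign, [g] is then positive
    at some generator, since the generators span. *)
Lemma active_step u f : (forall g, (forall i, lorentz g (row i X) = 0) -> g = 0) ->
  (\rank (active f) < n)%N ->
  exists g, [/\ lorentz g u = 0,
    (forall i, lorentz f (row i X) = 0 -> lorentz g (row i X) = 0) &
    exists i, 0 < lorentz g (row i X)].
Proof.
move=> span rk.
have [|g g0 gA] := @exists_orthogonal R n _ (col_mx (active f) u).
  rewrite -addsmxE ltnS (leq_trans (mxrank_adds_leqif _ _)) //.
  by rewrite (leq_trans (leq_add (leqnn _) (rank_leq_row _))) // addn1.
have gu : lorentz g u = 0.
  have := gA (rshift m ord0); rewrite rowKd.
  by rewrite (_ : row ord0 u = u) //; apply/rowP => j; rewrite mxE.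
have gf i : lorentz f (row i X) = 0 -> lorentz g (row i X) = 0.
  move=> fi; have := gA (lshift 1 i).
  by rewrite rowKu row_active fi eqxx.
have [i gi] : exists i, lorentz g (row i X) != 0.
  apply: contrapT => h; move/eqP: g0; apply; apply: span => i.
  by apply/eqP/negPn/negP => gi; apply: h; exists i.
case: (ltgtP (lorentz g (row i X)) 0) gi => // gi _.
  exists (- g); split; first by rewrite lorentzNl gu oppr0.
    by move=> k /gf; rewrite lorentzNl => ->; rewrite oppr0.
  by exists i; rewrite lorentzNl oppr_gt0.
by exists g; split=> //; exists i.
Qed.

(** Among the functionals that are nonpositive on the generators and positive
    at [u], one vanishing on a maximal number of generators spans a facet: as
    long as its active generators have rank less than [n], it can be tilted
    along a direction that moves neither those generators nor [u], until a new
    generator becomes active. *)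
Lemma exists_facet_normal u f :
  (forall g, (forall i, lorentz g (row i X) = 0) -> g = 0) ->
  (forall i, lorentz f (row i X) <= 0) -> 0 < lorentz f u ->
  exists a, [/\ forall i, lorentz a (row i X) <= 0, 0 < lorentz a u &
    (n <= \rank (active a))%N].
Proof.
move=> span; have [k] := ubnP #|[pred i | lorentz f (row i X) != 0]|.
elim: k f => // k IH f; rewrite ltnS => fk f0 fu.
have [rk|rk] := leqP n (\rank (active f)); first by exists f.
have [g [gu gf [i0 gi0]]] := active_step u _ span rk.
(* [q i] is the tilt at which generator [i] becomes active; the smallest one
   keeps all the generators on the nonpositive side. *)
pose q i := - lorentz f (row i X) / lorentz g (row i X).
have [i gi mi] := @arg_minP _ _ _ i0 (fun i => 0 < lorentz g (row i X)) q gi0.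
have q0 : 0 <= q i by rewrite divr_ge0 ?oppr_ge0 // ltW.
have fgi : lorentz f (row i X) + q i * lorentz g (row i X) = 0.
  by rewrite /q divfK ?gt_eqF // addrN.
apply: (IH (f + q i *: g)).
- apply: leq_trans fk; apply: proper_card; apply/properP; split.
    apply/fintype.subsetP => j; rewrite !inE !lorentzE; apply: contraNneq => fj.
    by rewrite fj (gf _ fj) mulr0 addr0.
  exists i; rewrite !inE ?lorentzE ?fgi ?eqxx //.
  by apply: contraTneq gi => /gf ->; rewrite ltxx.
- move=> j; rewrite !lorentzE; have [gj|gj] := ltP 0 (lorentz g (row j X)).
    by have := mi j gj; rewrite {2}/q ler_pdivlMr //; lra.
  by have := f0 j; have := mulr_ge0_le0 q0 gj; lra.
- by rewrite !lorentzE gu mulr0 addr0.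
Qed.

End SupportingNormals.

Lemma row_free_mul_eq0 {F : fieldType} {m p : nat} {B : 'M[F]_(m, p)} {w : 'rV[F]_m} :
  row_free B -> w *m B = 0 -> w = 0.
Proof. by move=> fB wB; apply: (row_free_inj fB); rewrite /= wB mul0mx. Qed.

Section Facets.
Context {R : realType} {n : nat}.
Implicit Types (a b u c x : 'rV[R]_n.+1) (P V : set 'rV[R]_n.+1).

Lemma lorentz_nondegenerate a : (forall x, lorentz a x = 0) -> a = 0.
Proof.
move=> h; apply/rowP => j; rewrite mxE; have := h (delta_mx 0 j); rewrite /lorentz.
case: (unliftP ord0 j) => [i|] ->.
  rewrite (bigD1 i) //= big1 ?addr0 => [|k ki]; last first.
    by rewrite !mxE eqxx (inj_eq lift_inj) (negPf ki) mulr0.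
  by rewrite !mxE !eqxx mulr1 (negPf (neq_lift _ _)) mulr0 subr0.
rewrite big1 => [|i _].
  by rewrite !mxE !eqxx mulr1 sub0r => /eqP; rewrite oppr_eq0 => /eqP.
by rewrite !mxE eqxx eq_sym (negPf (neq_lift _ _)) mulr0.
Qed.

Lemma hyperplane_orth0 (M : 'M[R]_(n, n.+1)) x b : row_free M ->
  ~~ (x <= M)%MS -> (forall i, lorentz b (row i M) = 0) -> lorentz b x = 0 ->
  b = 0.
Proof.
move=> fM xM bM bx; apply: lorentz_nondegenerate => y.
have full : row_full (M + x)%MS.
  rewrite /row_full eqn_leq rank_leq_col /= -{1}(eqP fM); apply: rank_ltmx.
  rewrite ltmxE addsmxSl /=; apply: contra xM; apply: submx_trans.
  exact: addsmxSr.
have /sub_addsmxP[[w v] /= ->] : (y <= M + x)%MS by exact: submx_full.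
rewrite lorentzDr !lorentz_mulmx !big1 ?addr0 // => i _.
  by rewrite (_ : row i x = x) ?bx ?mulr0 //; apply/rowP => j; rewrite mxE ord1.
by rewrite bM mulr0.
Qed.

(** In the expansion of the square every product is nonpositive, and the pair
    [i], [j] contributes a negative one. *)
Lemma positive_comb_timelike m (B : 'M[R]_(m, n.+1)) (w : 'rV[R]_m) i j :
  (forall k, future_causal (row k B)) -> (forall k, 0 < w 0 k) ->
  lorentz (row i B) (row j B) < 0 ->
  lorentz (w *m B) (w *m B) < 0 /\ 0 < (w *m B) 0 ord0.
Proof.
move=> fB w0 ij.
have neg_sum (F : 'I_m -> R) k : (forall l, F l <= 0) -> F k < 0 -> \sum_l F l < 0.
  move=> F0 Fk; rewrite (bigD1 k) //=.
  by have := @sumr_le0 R _ (index_enum 'I_m) (fun l => l != k) F (fun l _ => F0 l); lra.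
have wB k : lorentz (w *m B) (row k B) = \sum_l w 0 l * lorentz (row k B) (row l B).
  by rewrite lorentzC lorentz_mulmx.
have le0 k l : w 0 l * lorentz (row k B) (row l B) <= 0.
  by rewrite pmulr_rle0 //; exact: lorentz_future_le0.
split.
  rewrite lorentz_mulmx; apply: (neg_sum _ i) => [k|].
    by rewrite pmulr_rle0 // wB sumr_le0.
  by rewrite pmulr_rlt0 // wB; apply: (neg_sum _ j) => [k|]; rewrite ?pmulr_rlt0.
have Bk k : 0 < B k ord0 by have [_] := fB k; rewrite mxE.
rewrite mxE (bigD1 i) //= ltr_pwDl ?mulr_gt0 // sumr_ge0 // => k _.
by rewrite mulr_ge0 // ltW.
Qed.

(** Orthogonal future causal vectors are parallel, so independent ones have
    negative product. *)
Lemma row_free_lorentz_lt0 m (B : 'M[R]_(m, n.+1)) i j :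
  row_free B -> (forall k, future_causal (row k B)) -> i != j ->
  lorentz (row i B) (row j B) < 0.
Proof.
move=> freeB fB ij; rewrite lt_neqAle lorentz_future_le0 // andbT.
apply/eqP => /(lorentz_future_eq0 _ _ (fB i) (fB j)); have [_] := fB j.
move: (row i B 0 ord0) (row j B 0 ord0) => u v v0 /eqP.
rewrite -subr_eq0 !rowE !scalemxAl -mulmxBl => /eqP /(row_free_mul_eq0 freeB).
move=> /rowP /(_ i); rewrite !mxE !eqxx (negPf ij) mulr0 subr0 mulr1 => v00.
by rewrite v00 ltxx in v0.
Qed.

Lemma row_free_nonzero m (B : 'M[R]_(m, n.+1)) i : row_free B -> row i B != 0.
Proof.
move=> freeB; apply/eqP; rewrite rowE => /(row_free_mul_eq0 freeB).
by move=> /rowP /(_ i) /eqP; rewrite !mxE !eqxx oner_eq0.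
Qed.

(** These are rescaled rows of [1 + J], with [J] the all-ones matrix.  A vanishing
    combination of them gives one equation for each column; adding these shows
    that the coefficients have zero weighted sum, and then each vanishes. *)
Lemma row_free_add_ones m (t : 'I_m -> R) : (forall i, 0 < t i) ->
  row_free (\matrix_(i, j) (t i * (1 + (i == j)%:R))).
Proof.
move=> t0; rewrite -kermx_eq0; apply/rowV0P => w /sub_kermxP /rowP h.
set s := \sum_i w 0 i * t i.
have hj j : w 0 j * t j = - s.
  have := h j; rewrite !mxE (eq_bigr (fun i => w 0 i * t i + w 0 i * t i * (i == j)%:R)).
    rewrite big_split /= -/s [X in _ + X](bigD1 j) //= eqxx mulr1 big1 ?addr0.
      by move=> /eqP; rewrite addrC addr_eq0 => /eqP.
    by move=> i /negPf ->; rewrite mulr0.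
  by move=> i _; rewrite mxE; ring.
have s0 : s = 0.
  have : s = - s *+ m by rewrite {1}/s (eq_bigr _ (fun i _ => hj i)) sumr_const card_ord.
  by move=> /eqP; rewrite -subr_eq0 mulNrn opprK -mulrS mulrn_eq0 => /eqP.
apply/rowP => j; rewrite mxE; have := hj j; rewrite s0 oppr0 => /eqP.
by rewrite mulf_eq0 (gt_eqF (t0 j)) orbF => /eqP.
Qed.

End Facets.

(** [hdim F n.-1] asks for a matrix with [n.-1.+1] rows; this avoids the
    dependent mismatch with [n]. *)
Lemma hdim_pred (R : realType) (n : nat) (F : set 'rV[R]_n.+1) (M : 'M[R]_(n, n.+1)) :
  (0 < n)%N -> row_free M -> (forall i, F (row i M)) ->
  (forall x, F x -> (x <= M)%MS) -> hdim F n.-1.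
Proof. by case: n F M => // n F M _ fM FM sM; exists M. Qed.

Lemma row_free_subfamily (R : realType) (m n p : nat) (A : 'M[R]_(m, p)) :
  \rank A = n -> exists f : 'I_n -> 'I_m, row_free (rowsub f A).
Proof. by move=> <-; exists (maxrankfun A); exact: maxrowsub_free. Qed.

(** Independent active generators [b_i] can all be ideal, so they do not witness
    the dimension of the face.  The vectors [b_i + \sum_j b_j] do: they are
    timelike because [n >= 2] provides two nonparallel generators, they lie in
    the hull up to scaling, and they are independent because [1 + J] is
    invertible. *)
Lemma active_facet (R : realType) (n m : nat) (V : set 'rV[R]_n.+1)
    (X : 'M[R]_(m, n.+1)) (a : 'rV[R]_n.+1) :
  (2 <= n)%N -> V `<=` @hspace R n `|` @hboundary R n ->
  (forall v, V v <-> exists i, v = row i X) -> a != 0 ->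
  (forall i, lorentz a (row i X) <= 0) -> (n <= \rank (active X a))%N ->
  facets (hhull V) (hhull V `&` [set x | lorentz a x = 0]).
Proof.
move=> n2 sV VX a0 aX rk; set W := active X a in rk *.
have aV : hhull V `<=` [set x | lorentz a x <= 0].
  by apply: hhull_halfspace => // v /VX[i ->].
have rkW : \rank W = n.
  apply/eqP; rewrite eqn_leq rk andbT leqNgt; apply: contra a0 => rkW.
  apply/eqP/lorentz_nondegenerate => y.
  have /submxP[w ->] : (y <= W)%MS by apply: submx_full; rewrite /row_full eqn_leq rank_leq_col.
  by rewrite lorentz_mulmx big1 // => i _; rewrite active_orth mulr0.
have [f freeB] := row_free_subfamily _ _ _ _ _ rkW; set B := rowsub f W in freeB.
have rowB i : row i B = row (f i) X /\ lorentz a (row i B) = 0.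
  have := row_free_nonzero _ _ i freeB; rewrite row_rowsub row_active.
  by case: (eqVneq (lorentz a (row (f i) X)) 0) => // _; rewrite eqxx.
have VB i : V (row i B) by apply/VX; exists (f i); exact: (rowB i).1.
have fB i : future_causal (row i B) by exact/future_causal_hclosure/sV.
pose i0 : 'I_n := Ordinal (ltnW n2); pose i1 : 'I_n := Ordinal n2.
pose D (i : 'I_n) : 'rV[R]_n := \row_j (1 + (i == j)%:R).
have D0 i j : 0 < D i 0 j by rewrite mxE ltr_pwDl.
have b01 : lorentz (row i0 B) (row i1 B) < 0 by exact: row_free_lorentz_lt0.
have /choice[t tP] : forall i, exists t, 0 < t /\ hspace (t *: (D i *m B)).
  move=> i; have [q0 q1] := positive_comb_timelike _ _ (D i) _ _ fB (D0 i) b01.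
  have [t t0 ht] := timelike_normalize _ q0 q1; by exists t.
pose T := \matrix_(i, j) (t i * (1 + (i == j)%:R)).
have rowT i : row i (T *m B) = t i *: (D i *m B).
  rewrite row_mul scalemxAl; congr (_ *m _).
  by apply/rowP => j; rewrite !mxE.
have freeM : row_free (T *m B).
  rewrite -kermx_eq0; apply/rowV0P => w /sub_kermxP; rewrite mulmxA.
  move=> /(row_free_mul_eq0 freeB) /(row_free_mul_eq0 _); apply.
  by apply: row_free_add_ones => i; have [] := tP i.
have MF i : (hhull V `&` [set x | lorentz a x = 0]) (row i (T *m B)).
  have [ti hi] := tP i; split; last first.
    by rewrite /= row_mul lorentz_mulmx big1 // => j _; rewrite (rowB j).2 mulr0.
  rewrite row_mul; apply: hhull_cone => // [j|]; last by rewrite -row_mul rowT.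
  by rewrite !mxE mulr_ge0 ?(ltW ti) // addr_ge0.
(* [a] is spacelike because it is orthogonal to a point of the face. *)
split.
  exists a; split=> //; apply: (orth_timelike_spacelike (row i0 (T *m B))) => //.
    by have [[_ [-> _]] _] := MF i0; exact: ltrN10.
  by rewrite lorentzC; have [] := MF i0.
apply: (hdim_pred _ _ _ _ _ freeM MF); first exact: ltnW.
move=> x [_ ax]; apply/negPn/negP => xM; move/eqP: a0; apply.
by apply: (hyperplane_orth0 _ _ _ freeM xM) => // i; have [] := MF i.
Qed.

Section FacetCount.
Context {R : realType} {n : nat}.
Implicit Types (a b c x y : 'rV[R]_n.+1) (r : R) (P : set 'rV[R]_n.+1).

(** Since [P] has no hyperideal vertex, it is enough that [c + y] be
    spacelike. *)
Lemma exists_separating_facet P c r y : (2 <= n)%N -> hpolytope P ->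
  hspace c -> 0 < r -> hball c r `<=` P -> lorentz c y = 0 -> 1 < lorentz y y ->
  exists a, [/\ facets P (P `&` [set x | lorentz a x = 0]),
    P `<=` [set x | lorentz a x <= 0] & 0 < lorentz a (c + y)].
Proof.
move=> n2 [[V [finV sV ->]] _] hc r0 bP cy yy.
have /finite_seqP[s eV] := finV.
pose X := \matrix_(i < size s) nth 0 s i.
have VX v : V v <-> exists i, v = row i X.
  rewrite eV; split=> [vs|[i ->]]; last by rewrite rowK; apply: mem_nth.
  have lt : (index v s < size s)%N by rewrite index_mem.
  by exists (Ordinal lt); rewrite rowK nth_index.
have V_row i : V (row i X) by apply/VX; exists i.
have X_le a : (forall i, lorentz a (row i X) <= 0) ->
    hhull V `<=` [set x | lorentz a x <= 0].
  by move=> aX; apply: hhull_halfspace => // v /VX[i ->].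
have span g : (forall i, lorentz g (row i X) = 0) -> g = 0.
  move=> gX; apply: (hball_orth0 _ _ _ hc r0) => x /bP Px; apply/eqP.
  rewrite eq_le (X_le g) //=; last by move=> i; rewrite gX.
  by rewrite -oppr_le0 -lorentzNl (X_le (- g)) // => i; rewrite lorentzNl gX oppr0.
have [cc c0] := hc.
have fc : future_causal c by split=> //; rewrite cc lerN10.
have q1 : 1 < Num.sqrt (lorentz y y) by rewrite -sqrtr1 ltr_sqrt //; lra.
have qq : Num.sqrt (lorentz y y) ^+ 2 = lorentz y y by rewrite sqr_sqrtr //; lra.
move: (Num.sqrt _) q1 qq => q q1 qq.
(* A future null vector is nonpositive on the whole future cone; this one,
   pointing towards [y], is positive at [c + y] because [|y| > 1]. *)
pose f := q *: c + y.
have cf : lorentz c f = - q by rewrite /f !lorentzE cc cy; ring.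
have ff : lorentz f f = 0 by rewrite /f !lorentzE (lorentzC y c) cc cy -qq; ring.
have fu : 0 < lorentz f (c + y).
  by rewrite /f !lorentzE (lorentzC y c) cc cy -qq; nra.
have futf : future_causal f.
  by apply: (future_causal_of_lorentz _ _ fc); rewrite ?ff ?cf //; lra.
have fX i : lorentz f (row i X) <= 0.
  exact/lorentz_future_le0/future_causal_hclosure/sV.
have [a [aX au rk]] := exists_facet_normal _ _ _ span fX fu.
exists a; split=> //; last exact: X_le.
apply: active_facet rk => //; apply: contraTneq au => ->.
by rewrite lorentzC lorentz0r ltxx.
Qed.

(** A facet spans its hyperplane, so its normals are proportional; the values at
    [c] tell the factor, which is positive when both are negative. *)
Lemma facet_normal_unique P c a b : (0 < n)%N ->
  hdim (P `&` [set x | lorentz a x = 0]) n.-1 ->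
  P `&` [set x | lorentz a x = 0] = P `&` [set x | lorentz b x = 0] ->
  lorentz a c < 0 -> lorentz b c *: a = lorentz a c *: b.
Proof.
case: n c a b P => // k c a b P _ [M [freeM MF _]] eF ac.
apply/eqP; rewrite -subr_eq0; apply/eqP.
apply: (hyperplane_orth0 M c _ freeM).
- apply: contraTN ac => /submxP[w ->].
  by rewrite lorentz_mulmx big1 ?ltxx // => i _; rewrite (MF i).2 mulr0.
- move=> i; have ai := (MF i).2; have := MF i; rewrite eF => -[_ bi].
  by rewrite !lorentzE ai bi !mulr0 subr0.
- by rewrite !lorentzE mulrC subrr.
Qed.

(** * Counting facets *)

(** If one facet cut off [c + x_j] and [c + x_k], its normal would be positive
    at their midpoint, whose ray meets the ball and hence [P].  The last
    hypothesis is the condition of [hball_ray] for these midpoints. *)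
Lemma facet_count P c r N M (x : nat -> 'rV[R]_n.+1) : (2 <= n)%N ->
  hpolytope P -> (facets P #= `I_N)%card ->
  hspace c -> 0 < r -> hball c r `<=` P ->
  (forall j, (j < M)%N -> lorentz c (x j) = 0 /\ 1 < lorentz (x j) (x j)) ->
  (forall j k, (j < k < M)%N ->
     1 <= cosh r ^+ 2 * (1 - lorentz (x j + x k) (x j + x k) / 4)) ->
  (M <= N)%N.
Proof.
move=> n2 hP cP hc r0 bP hx hmid.
have /choice[a ha] : forall j, exists a, (j < M)%N ->
    [/\ facets P (P `&` [set x | lorentz a x = 0]),
    P `<=` [set x | lorentz a x <= 0] & 0 < lorentz a (c + x j)].
  move=> j; have [jM|] := boolP (j < M)%N; last by exists 0.
  have [cx xx] := hx j jM.
  by have [a ?] := exists_separating_facet _ _ _ _ n2 hP hc r0 bP cx xx; exists a.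
pose F j := P `&` [set x | lorentz (a j) x = 0].
have neq j k : (j < k < M)%N -> F j <> F k.
  move=> /[dup] jkM /andP[jk kM] eF; have jM := ltn_trans jk kM.
  have [[_ Fj] Pj uj] := ha j jM; have [_ Pk uk] := ha k kM.
  have neg i : (i < M)%N -> lorentz (a i) c < 0.
    move=> /ha[_ Pi ui]; apply: (hball_halfspace_lt _ _ _ hc r0) => [|z /bP /Pi //].
    by apply: contraTneq ui => ->; rewrite lorentzC lorentz0r ltxx.
  have e := facet_normal_unique _ c _ _ (ltnW n2) Fj eF (neg j jM).
  have jk0 : 0 < lorentz (a j) (c + x k).
    have := congr1 (fun z => lorentz z (c + x k)) e; rewrite /= !lorentzZl => e'.
    have : lorentz (a j) c * lorentz (a k) (c + x k) < 0.
      by rewrite nmulr_rlt0 // neg.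
    by rewrite -e' nmulr_rlt0 // neg.
  have cy : lorentz c (2^-1 *: (x j + x k)) = 0.
    by rewrite !lorentzE (hx j jM).1 (hx k kM).1; ring.
  have [] := hball_ray _ _ _ hc (ltW r0) cy.
    apply: le_trans (hmid _ _ jkM) _; rewrite lorentzZl lorentzZr le_eqVlt.
    by apply/orP; left; apply/eqP; field.
  move=> t t0 /bP /Pj /=; rewrite lorentzZr leNgt mulr_gt0 //.
  rewrite (_ : c + _ = 2^-1 *: ((c + x j) + (c + x k))); last first.
    by rewrite addrACA -mulr2n [RHS]scalerDr -(scaler_nat 2 c) scalerA mulVf ?scale1r.
  by rewrite lorentzZr mulr_gt0 ?invr_gt0 // lorentzDr addr_gt0.
have injF : {in `I_M &, injective F}.
  move=> j k; rewrite !inE /= => jM kM eF.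
  by case: (ltngtP j k) => // jk; [case: (neq j k)|case: (neq k j)]; rewrite ?jk.
rewrite -card_le_II -(card_le_eqr cP) -(card_le_eql (inj_card_eq injF)).
by apply: subset_card_le => _ [j jM <-]; have [] := ha j jM.
Qed.

Lemma orthonormal_tangent_pair c : (2 <= n)%N -> hspace c ->
  exists e1 e2, [/\ lorentz c e1 = 0, lorentz c e2 = 0,
    lorentz e1 e1 = 1, lorentz e2 e2 = 1 & lorentz e1 e2 = 0].
Proof.
move=> n2 [cc _].
have cc0 : lorentz c c < 0 by rewrite cc ltrN10.
have unit e : e != 0 -> lorentz c e = 0 ->
    exists2 t, 0 < t & lorentz (t *: e) (t *: e) = 1.
  move=> e0 ce; have ee := orth_timelike_spacelike _ _ cc0 ce e0.
  exists (Num.sqrt (lorentz e e))^-1; first by rewrite invr_gt0 sqrtr_gt0.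
  by rewrite lorentzZl lorentzZr mulrA -expr2 exprVn sqr_sqrtr ?ltW // mulVf ?gt_eqF.
have rowE1 (z : 'rV[R]_n.+1) : row ord0 z = z by apply/rowP => j; rewrite mxE.
have [|e1 e10 o1] := @exists_orthogonal R n _ c.
  by rewrite (leq_ltn_trans (rank_leq_row _)) // ltnS (ltnW n2).
have ce1 : lorentz c e1 = 0 by rewrite lorentzC -[c]rowE1 o1.
have [|e2 e20 o2] := @exists_orthogonal R n _ (col_mx c e1).
  by rewrite (leq_ltn_trans (rank_leq_row _)).
have ce2 : lorentz c e2 = 0.
  by have := o2 (lshift 1 ord0); rewrite rowKu rowE1 lorentzC.
have e12 : lorentz e1 e2 = 0.
  by have := o2 (rshift 1 ord0); rewrite rowKd rowE1 lorentzC.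
have [t1 t10 u1] := unit _ e10 ce1; have [t2 t20 u2] := unit _ e20 ce2.
exists (t1 *: e1), (t2 *: e2); split=> //.
- by rewrite lorentzZr ce1 mulr0.
- by rewrite lorentzZr ce2 mulr0.
- by rewrite lorentzZl lorentzZr e12 !mulr0.
Qed.

End FacetCount.

Section InradiusBound.
Context {R : realType} {n : nat}.
Implicit Types (P : set 'rV[R]_n.+1) (c : 'rV[R]_n.+1) (r : R).

(** Two opposite directions are cut off by distinct facets, their midpoint being
    the centre of the ball. *)
Lemma facets_ge2 P c r N : (2 <= n)%N -> hpolytope P -> (facets P #= `I_N)%card ->
  hspace c -> 0 < r -> hball c r `<=` P -> (2 <= N)%N.
Proof.
move=> n2 hP cP hc r0 bP; have [e [_ [ce _ ee _ _]]] := orthonormal_tangent_pair _ n2 hc.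
apply: (facet_count _ _ _ _ _ (fun j => if j is 0%N then 2 *: e else - (2 *: e))
  n2 hP cP hc r0 bP) => [j _|j k /andP[jk k2]].
  by case: j => [|j]; rewrite !lorentzE ce ee; split; lra.
case: k k2 jk => [|[|k]] // _; case: j => [|j] // _.
by rewrite subrr lorentz0r mul0r subr0 mulr1; have := cosh_gt1 _ r0; nra.
Qed.

(** Taking abscissas [j / M] on a circle keeps the points [1 / M] apart without
    any trigonometry. *)
Lemma facets_ge_radius P c r N M : (2 <= n)%N -> hpolytope P ->
  (facets P #= `I_N)%card -> hspace c -> 0 < r -> hball c r `<=` P ->
  4 * M%:R <= cosh r -> (M <= N)%N.
Proof.
move=> n2 hP cP hc r0 bP hM.
have [e1 [e2 [ce1 ce2 e11 e22 e12]]] := orthonormal_tangent_pair _ n2 hc.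
case: M hM => // m; set M := m.+1 => hM.
have M0 : 0 < M%:R :> R by rewrite ltr0n.
pose d : R := (M%:R)^-1.
have d0 : 0 < d by rewrite invr_gt0.
have hd : 4 <= cosh r * d by rewrite ler_pdivlMr.
(* The squared radius [l] exceeds [1], and a chord of length at least [d]
   lowers the squared norm of its midpoint to at most [l - d ^+ 2 / 4], which
   leaves a margin of [d ^+ 2 / 8] below [1]. *)
pose l : R := 1 + d ^+ 2 / 8.
pose t j : R := j%:R * d.
pose s j := Num.sqrt (l - t j ^+ 2).
have sE j : (j < M)%N -> s j ^+ 2 = l - t j ^+ 2.
  move=> jM; rewrite sqr_sqrtr // /l.
  have t0 : 0 <= t j by rewrite mulr_ge0 ?ler0n ?(ltW d0).
  have t1 : t j <= 1 by rewrite /t ler_pdivrMr // mul1r ler_nat ltnW.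
  by nra.
have normE p q : lorentz (p *: e1 + q *: e2) (p *: e1 + q *: e2) = p ^+ 2 + q ^+ 2.
  by rewrite !lorentzE (lorentzC e2 e1) e11 e22 e12; ring.
apply: (facet_count _ _ _ _ _ (fun j => t j *: e1 + s j *: e2)
  n2 hP cP hc r0 bP) => [j jM|j k /andP[jk kM]].
  rewrite normE sE // !lorentzE ce1 ce2 !mulr0 addr0; split=> //.
  by rewrite addrC subrK /l ltrDl; nra.
have jM := ltn_trans jk kM; have sj := sE _ jM; have sk := sE _ kM.
rewrite addrACA -(scalerDl e1 (t j)) -(scalerDl e2 (s j)) normE.
have htjk : d <= t k - t j.
  rewrite /t -mulrBl ler_peMl ?(ltW d0) // -natrB ?(ltnW jk) //.
  by rewrite ler1n subn_gt0.
have mid : d ^+ 2 / 8 <= 1 - ((t j + t k) ^+ 2 + (s j + s k) ^+ 2) / 4.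
  have : d ^+ 2 <= (t k - t j) ^+ 2 by rewrite ler_sqr ?nnegrE //; lra.
  have := sqr_ge0 (s j - s k); rewrite /l in sj sk.
  by nra.
have ch : 16 <= cosh r ^+ 2 * d ^+ 2 by rewrite -exprMn; move: (cosh r * d) hd => z hz; nra.
have := ler_wpM2l (sqr_ge0 (cosh r)) mid; lra.
Qed.

End InradiusBound.

Theorem theorem6p2 (R : realType) (n : nat) (hn : (2 <= n)%N) :
  exists C : R, forall (P : set 'rV[R]_n.+1) (N : nat),
    hpolytope P -> (facets P #= `I_N)%card ->
    (inradius P <= (C * ln N%:R)%:E)%E.
Proof.
(* [expR r / 8 < N + 1] and [N >= 2] give [expR r <= 16 * N <= N ^+ 5]. *)
exists 5 => P N hP cP; apply: ge_ereal_sup => _ [r [r0 [c hc bP]] <-].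
have N2 := facets_ge2 _ _ _ _ hn hP cP hc r0 bP.
pose M := Num.trunc (expR r / 8).
have e0 : 0 <= expR r / 8 by rewrite divr_ge0 // expR_ge0.
have /andP[Mle Mgt] := truncn_itv e0.
rewrite -/M in Mle Mgt.
have MN : (M <= N)%N.
  apply: (facets_ge_radius _ _ _ _ _ hn hP cP hc r0 bP).
  by rewrite /cosh; have := expR_gt0 (- r); lra.
have N0 : 0 < N%:R :> R by rewrite ltr0n ltnW.
have N2' : 2 <= N%:R :> R by rewrite ler_nat.
have eN : expR r <= N%:R ^+ 5.
  have : M.+1%:R <= N%:R + 1 :> R by rewrite natr1 ler_nat ltnS.
  have h2 : 2 ^+ 4 <= N%:R ^+ 4 :> R by rewrite lerXn2r ?nnegrE // ltW.
  have : 2 ^+ 4 * N%:R <= N%:R ^+ 5 :> R by rewrite [leRHS]exprSr ler_pM2r.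
  by lra.
rewrite lee_fin -[leLHS]expRK.
have -> : 5 * ln N%:R = ln (N%:R ^+ 5) :> R by rewrite lnXn // mulr_natl.
by rewrite ler_ln ?posrE ?expR_gt0 ?exprn_gt0.
Qed.
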